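(* Let $\mathbb{R}^n$ be equipped with an orthonormal basis $\{\vec e_1,\dots,\vec e_n\}$ and let $\vec n=\vec e_1$. For every vector $\vec x\in\mathbb{R}^n$ and every integer $p\ge 1$, the element $$(\vec x\diamond\vec n)^p\diamond\vec n$$ of $Cl(\mathbb{R}^n)$ is a vector in $\mathbb{R}^n$; that is, $(\vec x\diamond\vec n)^p\diamond\vec n\in\langle Cl(\mathbb{R}^n)\rangle_1$.
   Context: $Cl(\mathbb{R}^n)$ is the real Clifford (geometric) algebra of $\mathbb{R}^n$ with its standard inner product $\cdot$: the associative unital real algebra generated by $\mathbb{R}^n$ subject to $\vec v\diamond\vec v=\vec v\cdot\vec v$ for $\vec v\in\mathbb{R}^n$. $\diamond$ denotes the product of this algebra (the geometric product); for vectors, $\vec a\diamond\vec b=\vec a\cdot\vec b+\vec a\wedge\vec b$, with $\wedge$ the outer (exterior) product. $\mathbb{R}^n$ is identified with its image in $Cl(\mathbb{R}^n)$, which is the grade-$1$ subspace $\langle Cl(\mathbb{R}^n)\rangle_1$. Powers are taken with respect to $\diamond$. The integer $n$ (dimension) and the vector $\vec n$ are unrelated. *)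

(* Defs.v *)
From HB Require Import structures.
From mathcomp Require Import all_boot all_order all_algebra.

Set Implicit Arguments.
Unset Strict Implicit.
Unset Printing Implicit Defensive.

Import Order.TTheory GRing.Theory.
Local Open Scope ring_scope.

Definition symdiff (T : finType) (A B : {set T}) : {set T} :=
  [set i | (i \in A) (+) (i \in B)].

(* The element x of Cl(R^n) is encoded by its coordinates on the blades
   e_A = e_{a_1} ... e_{a_k}, A = {a_1 < ... < a_k}, where e_i is the i-th
   standard basis vector.  This is a copy of a finite function space because
   finite functions already carry the pointwise product. *)
Definition clifford (R : comNzRingType) (n : nat) : Type :=
  {ffun {set 'I_n} -> R^o}.

HB.instance Definition _ (R : comNzRingType) (n : nat) :=
  GRing.Lmodule.copy (clifford R n) {ffun {set 'I_n} -> R^o}.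

Section Clifford.
Variables (R : comNzRingType) (n : nat).
Local Notation Cl := (clifford R n).
Implicit Types (A B C : {set 'I_n}) (x y z : Cl) (u v : 'rV[R]_n).

Definition coord x A : R := (x : {ffun {set 'I_n} -> R^o}) A.

Definition blade A : Cl := [ffun B => (B == A)%:R].

(* e_A e_B = csign A B e_{A symdiff B}: sorting the concatenation costs a sign
   for each inversion, after which repeated factors cancel since e_i e_i = 1. *)
Definition csign A B : R := \prod_(i in A) \prod_(j in B | (j < i)%N) -1.

Definition cmul x y : Cl :=
  \sum_A \sum_B (coord x A * coord y B * csign A B) *: blade (symdiff A B).

Lemma coordD x y A : coord (x + y) A = coord x A + coord y A.
Proof. by rewrite /coord ffunE. Qed.

Lemma coordZ a x A : coord (a *: x) A = a * coord x A.
Proof. by rewrite /coord ffunE. Qed.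

Lemma coord_sum I (r : seq I) (F : I -> Cl) A :
  coord (\sum_(i <- r) F i) A = \sum_(i <- r) coord (F i) A.
Proof.
by elim/big_rec2: _ => [|i a x _ <-]; [rewrite /coord ffunE | rewrite coordD].
Qed.

Lemma coord_inj x y : coord x =1 coord y -> x = y.
Proof. by move=> xy; apply/ffunP => A; apply: xy. Qed.

Lemma coord_blade A B : coord (blade A) B = (B == A)%:R.
Proof. by rewrite /coord ffunE. Qed.

Lemma coordE x : x = \sum_A coord x A *: blade A.
Proof.
apply: coord_inj => B; rewrite coord_sum (bigD1 B) //= big1 ?addr0.
  by rewrite coordZ coord_blade eqxx mulr1.
by move=> A /negbTE nAB; rewrite coordZ coord_blade eq_sym nAB mulr0.
Qed.

Lemma cmulDl : left_distributive cmul +%R.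
Proof.
move=> x y z; rewrite /cmul -big_split; apply: eq_bigr => A _ /=.
by rewrite -big_split; apply: eq_bigr => B _ /=; rewrite coordD !mulrDl scalerDl.
Qed.

Lemma cmulDr : right_distributive cmul +%R.
Proof.
move=> x y z; rewrite /cmul -big_split; apply: eq_bigr => A _ /=.
rewrite -big_split; apply: eq_bigr => B _ /=.
by rewrite coordD mulrDr mulrDl scalerDl.
Qed.

Lemma cmulZl a x y : cmul (a *: x) y = a *: cmul x y.
Proof.
rewrite /cmul scaler_sumr; apply: eq_bigr => A _; rewrite scaler_sumr.
by apply: eq_bigr => B _; rewrite coordZ scalerA !mulrA.
Qed.

Lemma cmulZr a x y : cmul x (a *: y) = a *: cmul x y.
Proof.
rewrite /cmul scaler_sumr; apply: eq_bigr => A _; rewrite scaler_sumr.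
by apply: eq_bigr => B _; rewrite coordZ scalerA mulrCA !mulrA.
Qed.

Lemma cmul_blade A B : cmul (blade A) (blade B) = csign A B *: blade (symdiff A B).
Proof.
rewrite /cmul (bigD1 A) //= (bigD1 B) //= !big1 => [|C nCA|C nCB].
- by rewrite !coord_blade !eqxx !mul1r !addr0.
- apply: big1 => D _.
  by rewrite coord_blade (negbTE nCA) !mul0r scale0r.
- by rewrite !coord_blade (negbTE nCB) mulr0 mul0r scale0r.
Qed.

Lemma prod_symdiff (I : finType) (F : I -> R) (A B : {set I}) :
    (forall i, F i * F i = 1) ->
  \prod_(i in symdiff A B) F i = (\prod_(i in A) F i) * (\prod_(i in B) F i).
Proof.
move=> FF; rewrite [LHS]big_mkcond [X in _ = X * _]big_mkcond.
rewrite [X in _ = _ * X]big_mkcond -big_split /=; apply: eq_bigr => i _.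
by rewrite inE; case: (i \in A); case: (i \in B); rewrite /= ?FF ?mulr1 ?mul1r.
Qed.

Lemma prodN1_sqr (I : finType) (P : pred I) :
  (\prod_(i | P i) -1) * (\prod_(i | P i) -1) = 1 :> R.
Proof. by rewrite -big_split big1 //= => i _; rewrite mulrNN mulr1. Qed.

Lemma csignDl A B C : csign (symdiff A B) C = csign A C * csign B C.
Proof. by rewrite /csign prod_symdiff // => i; rewrite prodN1_sqr. Qed.

Lemma csignDr A B C : csign A (symdiff B C) = csign A B * csign A C.
Proof.
rewrite /csign -big_split; apply: eq_bigr => i _ /=.
under eq_bigl do rewrite inE.
rewrite [LHS]big_mkcond [X in _ = X * _]big_mkcond [X in _ = _ * X]big_mkcond
  -big_split; apply: eq_bigr => j _ /=.
by case: (j \in B); case: (j \in C); case: (j < i)%N;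
  rewrite /= ?mulrNN ?mulr1 ?mul1r.
Qed.

Lemma symdiffA : associative (@symdiff 'I_n).
Proof. by move=> A B C; apply/setP => i; rewrite !inE addbA. Qed.

Lemma symdiff0s A : symdiff set0 A = A.
Proof. by apply/setP => i; rewrite !inE. Qed.

Lemma symdiffs0 A : symdiff A set0 = A.
Proof. by apply/setP => i; rewrite !inE addbF. Qed.

Lemma csign0l A : csign set0 A = 1.
Proof. by rewrite /csign big_set0. Qed.

Lemma csign0r A : csign A set0 = 1.
Proof. by rewrite /csign big1 // => i _; rewrite big1 // => j; rewrite inE. Qed.

Lemma blade_ind (P : Cl -> Prop) :
    (forall A, P (blade A)) -> (forall a x, P x -> P (a *: x)) ->
    (forall x y, P x -> P y -> P (x + y)) ->
  forall x, P x.
Proof.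
move=> Pb PZ PD x; rewrite (coordE x); apply: (big_ind P) => // [|A _].
  by rewrite -(scale0r (blade set0)); apply/PZ/Pb.
exact/PZ/Pb.
Qed.

Lemma cmulA : associative cmul.
Proof.
move=> x y z; elim/blade_ind: x => [A|a x IH|x x' IH IH']; last 2 first.
- by rewrite !cmulZl IH.
- by rewrite !cmulDl IH IH'.
elim/blade_ind: y => [B|a y IH|y y' IH IH']; last 2 first.
- by rewrite cmulZr !cmulZl cmulZr IH.
- by rewrite cmulDr !cmulDl cmulDr IH IH'.
elim/blade_ind: z => [C|a z IH|z z' IH IH']; last 2 first.
- by rewrite !cmulZr IH.
- by rewrite !cmulDr IH IH'.
rewrite !(cmul_blade, cmulZl, cmulZr) !scalerA csignDl csignDr symdiffA.
by congr (_ *: _); rewrite mulrC -mulrA.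
Qed.

Lemma cmul1x : left_id (blade set0) cmul.
Proof.
elim/blade_ind => [A|a x IH|x y IH IH']; rewrite ?cmulZr ?cmulDr ?IH ?IH' //.
by rewrite cmul_blade csign0l symdiff0s scale1r.
Qed.

Lemma cmulx1 : right_id (blade set0) cmul.
Proof.
elim/blade_ind => [A|a x IH|x y IH IH']; rewrite ?cmulZl ?cmulDl ?IH ?IH' //.
by rewrite cmul_blade csign0r symdiffs0 scale1r.
Qed.

Lemma blade0_neq0 : blade set0 != 0.
Proof.
apply/eqP => /(congr1 (coord^~ set0)) /eqP.
by rewrite coord_blade eqxx /coord ffunE oner_eq0.
Qed.

HB.instance Definition _ := GRing.Zmodule_isNzRing.Build Cl
  cmulA cmul1x cmulx1 cmulDl cmulDr blade0_neq0.

Let scale_cmulAl a x y : a *: (x * y) = (a *: x) * y.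
Proof. exact: esym (cmulZl _ _ _). Qed.
HB.instance Definition _ := GRing.Lmodule_isLalgebra.Build R Cl scale_cmulAl.

Let scale_cmulAr a x y : a *: (x * y) = x * (a *: y).
Proof. exact: esym (cmulZr _ _ _). Qed.
HB.instance Definition _ := GRing.Lalgebra_isAlgebra.Build R Cl scale_cmulAr.

Definition cvec v : Cl := \sum_i v 0 i *: blade [set i].

Let cvec_linear : linear cvec.
Proof.
move=> a u v; rewrite /cvec scaler_sumr -big_split.
by apply: eq_bigr => i _; rewrite /= !mxE scalerDl scalerA.
Qed.
HB.instance Definition _ := GRing.isLinear.Build R _ _ _ cvec cvec_linear.

(* Grade k is the span of the k-fold products of distinct basis vectors. *)
Definition grade (k : nat) : {pred Cl} :=
  [pred x | [forall A, (coord x A != 0) ==> (#|A| == k)]].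

Definition dot u v : R := \sum_i u 0 i * v 0 i.

Lemma coord_cvec1 v i : coord (cvec v) [set i] = v 0 i.
Proof.
rewrite coord_sum (bigD1 i) //= coordZ coord_blade eqxx mulr1.
rewrite big1 ?addr0 // => j nji.
by rewrite coordZ coord_blade (inj_eq set1_inj) eq_sym (negbTE nji) mulr0.
Qed.

Lemma coord_cvec v A : #|A| != 1%N -> coord (cvec v) A = 0.
Proof.
move=> A1; rewrite coord_sum big1 // => j _; rewrite coordZ coord_blade.
by case: eqP => [A_j|_]; rewrite ?mulr0 //; move: A1; rewrite A_j cards1.
Qed.

Lemma cvec_inj : injective cvec.
Proof. by move=> u v uv; apply/rowP => i; rewrite -!coord_cvec1 uv. Qed.

(* R^n, embedded by cvec, is exactly the grade-1 subspace. *)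
Lemma grade1P x : reflect (exists v, x = cvec v) (x \in grade 1).
Proof.
apply: (iffP forallP) => [x1 | [v ->] A]; last first.
  by apply/implyP; apply: contra_neqT => /coord_cvec.
exists (\row_i coord x [set i]); apply: coord_inj => A.
have [/cards1P[i ->]|A1] := boolP (#|A| == 1%N).
  by rewrite coord_cvec1 mxE.
rewrite coord_cvec //; apply: contraNeq A1; exact/implyP/x1.
Qed.

Lemma blade_mul A B : blade A * blade B = csign A B *: blade (symdiff A B).
Proof. exact: cmul_blade. Qed.

Lemma csign1l i A : csign [set i] A = \prod_(j in A | (j < i)%N) -1.
Proof. by rewrite /csign big_set1. Qed.

Lemma blade_anti i j : i != j ->
  blade [set i] * blade [set j] = - (blade [set j] * blade [set i]).
Proof.
wlog ij : i j / (i < j)%N => [hw|_].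
  case: (ltngtP i j) => [ij|ji|/val_inj->]; last by rewrite eqxx.
    exact: hw.
  by rewrite eq_sym => /(hw _ _ ji) ->; rewrite opprK.
rewrite !blade_mul !csign1l big1 => [|k]; last first.
  by rewrite inE => /andP[/eqP-> /ltnW]; rewrite leqNgt ij.
rewrite big_mkcondr big_set1 ij scaleN1r opprK scale1r.
by congr blade; apply/setP => k; rewrite !inE addbC.
Qed.

Lemma blade_sqr i : blade [set i] * blade [set i] = 1.
Proof.
rewrite blade_mul csign1l big_mkcondr big_set1 ltnn scale1r.
by congr blade; apply/setP => k; rewrite !inE addbb.
Qed.

(* The defining relation of the Clifford algebra. *)
Lemma cvec_sqr v : cvec v * cvec v = (dot v v)%:A.
Proof.
pose T (i j : 'I_n) := (v 0 i *: blade [set i]) * (v 0 j *: blade [set j]).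
have Tdiag i : T i i = (v 0 i * v 0 i)%:A.
  by rewrite /T -scalerAl -scalerAr scalerA blade_sqr.
have Tanti (i j : 'I_n) : (i < j)%N -> T i j = - T j i.
  move=> ij; rewrite /T -!scalerAl -!scalerAr !scalerA blade_anti ?scalerN.
    by rewrite mulrC.
  by rewrite neq_ltn ij.
have E (i : 'I_n) : \sum_j T i j =
    T i i + (\sum_(j : 'I_n | (i < j)%N) T i j + \sum_(j : 'I_n | (j < i)%N) T i j).
  rewrite (bigD1 i) //=; congr (_ + _).
  rewrite (bigID (fun j : 'I_n => (i < j)%N)) /=.
  by congr (_ + _); apply: eq_bigl => j; rewrite -val_eqE /=; case: ltngtP.
rewrite {1}/cvec mulr_suml.
under eq_bigr do rewrite /cvec mulr_sumr E Tdiag.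
rewrite big_split /= -[X in _ = X]addr0 /dot scaler_suml; congr (_ + _).
rewrite big_split /= [X in _ + X](exchange_big_dep xpredT) //= -big_split.
by rewrite big1 // => i _; rewrite -big_split big1 //= => j /Tanti ->; rewrite addNr.
Qed.

Lemma cvec_delta i : cvec (delta_mx 0 i) = blade [set i].
Proof.
rewrite /cvec (bigD1 i) //= big1 => [|j /negbTE nji].
  by rewrite mxE !eqxx scale1r addr0.
by rewrite mxE nji andbF scale0r.
Qed.

Let ord_lt : rel 'I_n := relpre val ltn.

Let ord_lt_trans : transitive ord_lt.
Proof. by move=> j i k; apply: ltn_trans. Qed.

Let ord_lt_irr : irreflexive ord_lt.
Proof. by move=> i; apply: ltnn. Qed.

Lemma enum_set_sorted A : sorted ord_lt (enum A).
Proof.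
apply: sorted_filter; first exact: ord_lt_trans.
by rewrite -enumT; have := iota_ltn_sorted 0 n; rewrite -val_enum_ord sorted_map.
Qed.

(* The image of R^n generates the algebra. *)
Lemma blade_prod A : blade A = \prod_(i <- enum A) cvec (delta_mx 0 i).
Proof.
have -> : blade A = blade [set i in enum A].
  by congr blade; apply/setP => i; rewrite inE mem_enum.
elim: (enum A) (enum_set_sorted A) => [|i s IHs] /=.
  by rewrite big_nil => _; congr blade; apply/setP => i; rewrite !inE.
rewrite (path_sortedE ord_lt_trans) => /andP[/allP lt_i /IHs {}IHs].
rewrite big_cons -IHs cvec_delta blade_mul csign1l big1 => [|j]; last first.
  by rewrite inE => /andP[/lt_i/ltnW]; rewrite leqNgt => /negbTE ->.
rewrite scale1r; congr blade; apply/setP => j; rewrite !inE; case: eqP => [->|//].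
by symmetry; apply/negP => /lt_i; rewrite ord_lt_irr.
Qed.

Lemma dotDl u u' v : dot (u + u') v = dot u v + dot u' v.
Proof. by rewrite -big_split; apply: eq_bigr => i _; rewrite /= mxE mulrDl. Qed.

Lemma dotC u v : dot u v = dot v u.
Proof. by apply: eq_bigr => i _; rewrite mulrC. Qed.

Lemma dot_delta i j : dot (delta_mx 0 i) (delta_mx 0 j) = (i == j)%:R.
Proof.
rewrite /dot (bigD1 i) //= big1 => [|k /negbTE nki]; last first.
  by rewrite mxE nki andbF mul0r.
by rewrite !mxE !eqxx mul1r addr0.
Qed.

(* (Cl(R^n), cvec) is the universal unital algebra with a linear map from R^n
   satisfying v v = dot v v. *)
Theorem clifford_universal (B : algType R) (j : {linear 'rV[R]_n -> B}) :
    (forall v, j v * j v = (dot v v)%:A) ->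
  exists2 f : {lrmorphism Cl -> B}, (forall v, f (cvec v) = j v)
    & forall g : {lrmorphism Cl -> B}, (forall v, g (cvec v) = j v) -> g =1 f.
Proof.
move=> jj; pose J i := j (delta_mx 0 i).
have JJ i : J i * J i = 1 by rewrite jj dot_delta eqxx scale1r.
have Janti i k : i != k -> J i * J k = - (J k * J i).
  move=> /negbTE nik; apply/eqP; rewrite -addr_eq0; apply/eqP.
  have := jj (delta_mx 0 i + delta_mx 0 k).
  rewrite linearD mulrDl !mulrDr -/(J i) -/(J k) !JJ.
  rewrite dotDl ![dot _ (_ + _)]dotC !dotDl !dot_delta !eqxx nik eq_sym nik.
  rewrite addr0 add0r scalerDl scale1r -!addrA => /addrI.
  by rewrite addrA -[RHS]add0r => /addIr.
pose P (s : seq 'I_n) := \prod_(k <- s) J k.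
have toggle i (s : seq 'I_n) : sorted ord_lt s -> exists t : seq 'I_n,
    [/\ sorted ord_lt t, forall k, (k \in t) = (k == i) (+) (k \in s)
    & J i * P s = (\prod_(k <- s | (k < i)%N) -1) *: P t].
  elim: s => [_|k s IHs sorted_ks].
    exists [:: i]; split=> // [k|]; first by rewrite inE addbF.
    by rewrite /P !big_nil big_seq1 mulr1 scale1r.
  have := sorted_ks; rewrite /= (path_sortedE ord_lt_trans) => /andP[/allP lt_k ss].
  have [lt_ki|lt_ik|/val_inj eq_ki] := ltngtP k i.
  - have [t [st t_def Et]] := IHs ss; exists (k :: t); split=> [|l|].
    + rewrite /= (path_sortedE ord_lt_trans) st andbT; apply/allP => l.
      rewrite t_def; have [->|_] := eqVneq l i; first by [].
      by rewrite addFb => /lt_k.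
    + rewrite !inE t_def; have [->|//] := eqVneq l k.
      by rewrite -val_eqE /= ltn_eqF //; case: (k \in s).
    + rewrite /P !big_cons lt_ki mulrA Janti; last first.
        by rewrite neq_ltn lt_ki orbT.
      by rewrite [LHS]mulNr -[in LHS]mulrA -[\prod_(_ <- s) _]/(P s) Et -scalerAr mulN1r scaleNr.
  - exists [:: i, k & s]; split=> [|l|].
    + by apply/andP; split.
    + rewrite !inE; have [->|//] := eqVneq l i.
      rewrite -val_eqE /= ltn_eqF //=; apply/esym/negP => /lt_k.
      by rewrite /ord_lt /= ltnNge ltnW.
    + rewrite [P (i :: _)]big_cons big_seq_cond big1 ?scale1r // => l.
      rewrite inE => /andP[/predU1P[->|/lt_k /ltnW le_kl]].
        by rewrite ltnNge ltnW.
      by rewrite ltnNge (leq_trans (ltnW lt_ik)).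
  - rewrite -eq_ki; exists s; split=> // [l|].
      rewrite inE; have [->|//] := eqVneq l k.
      by apply/negP => /lt_k; rewrite ord_lt_irr.
    rewrite [P (k :: _)]big_cons mulrA JJ mul1r.
    rewrite [X in X *: _]big_seq_cond [X in X *: _]big1 ?scale1r // => l.
    rewrite inE => /andP[/predU1P[->|/lt_k /ltnW le_kl]]; first by rewrite ltnn.
    by rewrite ltnNge le_kl.
pose F x := \sum_A coord x A *: P (enum A).
have F_lin : linear F.
  move=> a x y; rewrite /F scaler_sumr -big_split; apply: eq_bigr => A _ /=.
  by rewrite coordD coordZ scalerDl scalerA.
have FD x y : F (x + y) = F x + F y by have := F_lin 1 x y; rewrite !scale1r.
have F0 : F 0 = 0.
  by rewrite /F big1 // => A _; rewrite /coord ffunE scale0r.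
have FZ a x : F (a *: x) = a *: F x by have := F_lin a x 0; rewrite F0 !addr0.
have F_blade A : F (blade A) = P (enum A).
  rewrite /F (bigD1 A) //= coord_blade eqxx scale1r big1 ?addr0 // => C /negbTE nCA.
  by rewrite coord_blade nCA scale0r.
have F_gen i y : F (cvec (delta_mx 0 i) * y) = J i * F y.
  rewrite cvec_delta; elim/blade_ind: y => [A|a y IH|y z IHy IHz]; last 2 first.
  - by rewrite FZ -!scalerAr FZ IH.
  - by rewrite mulrDr !FD mulrDr IHy IHz.
  rewrite blade_mul FZ !F_blade csign1l.
  have [t [st t_def ->]] := toggle i _ (enum_set_sorted A).
  have -> : t = enum (symdiff [set i] A).
    apply: (irr_sorted_eq ord_lt_trans ord_lt_irr st (enum_set_sorted _)) => k.
    by rewrite t_def !mem_enum !inE.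
  by rewrite big_enum_cond.
have FM x y : F (x * y) = F x * F y.
  elim/blade_ind: x => [A|a x IH|x z IHx IHz]; last 2 first.
  - by rewrite FZ -!scalerAl FZ IH.
  - by rewrite mulrDl !FD mulrDl IHx IHz.
  rewrite F_blade blade_prod /P; elim: (enum A) => [|i s IHs].
    by rewrite !big_nil !mul1r.
  by rewrite !big_cons -!mulrA F_gen IHs.
have F1 : F 1 = 1 by rewrite -[1]/(blade set0) F_blade enum_set0 /P big_nil.
pose Flin := GRing.isLinear.Build R Cl B *:%R F F_lin.
pose Fmor := GRing.isMonoidMorphism.Build Cl B F (F1, FM).
pose f : {lrmorphism Cl -> B} := HB.pack F Flin Fmor.
exists f => [v|g gj x].
  rewrite [in RHS](row_sum_delta v) !linear_sum; apply: eq_bigr => i _ /=.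
  rewrite [RHS]linearZ FZ -cvec_delta -[cvec _]mulr1 F_gen.
  by rewrite F1 mulr1.
elim/blade_ind: x => [A|a x IH|x y IHx IHy]; last 2 first.
- by rewrite [LHS]linearZ [RHS]linearZ /= IH.
- by rewrite [LHS]linearD [RHS]linearD /= IHx IHy.
rewrite /= F_blade blade_prod rmorph_prod; apply: eq_bigr => i _; exact: gj.
Qed.

End Clifford.

Arguments cvec {R n} v.
Arguments grade {R n} k.

Definition orthonormal_basis (F : fieldType) (n : nat) (e : n.-tuple 'rV[F]_n) :
    Prop :=
  basis_of fullv e /\
  forall i j : 'I_n, dot (tnth e i) (tnth e j) = (i == j)%:R.

(* Main.v *)
Require Import Defs.
From mathcomp Require Import all_boot all_order all_algebra.
From mathcomp Require Import reals.

Set Implicit Arguments.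
Unset Strict Implicit.
Unset Printing Implicit Defensive.

Import GRing.Theory.
Local Open Scope ring_scope.

(** A product of two vectors a = u v is quadratic over the scalars.  Its
    reverse v u is 2 (u . v) - a by polarization, and a (v u) = u (v v) u is
    the scalar (u . u)(v . v), so a ^ 2 = 2 (u . v) a - (u . u)(v . v).
    Multiplying by a ^ p on the left and by v on the right, the elements
    a ^ p v obey a linear recurrence of order two with scalar coefficients
    ([mul_cvec_sqr]).  Its first two terms, v and u v v = (v . v) u, are
    vectors, and vectors are closed under linear combinations, hence every
    a ^ p v is a vector ([mul_cvec_exp_grade1]). *)

(** Polarization of the relation v v = v . v. *)
Lemma cvec_anticomm (R : comNzRingType) (n : nat) (u v : 'rV[R]_n) :
  cvec u * cvec v + cvec v * cvec u = (dot u v *+ 2)%:A.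
Proof.
have := cvec_sqr (u + v); rewrite mulr2n.
rewrite linearD mulrDl !mulrDr !cvec_sqr dotDl ![dot _ (u + v)]dotC !dotDl.
rewrite [dot v u]dotC !scalerDl -!addrA => /addrI.
by rewrite !addrA => /addIr.
Qed.

Lemma mul_cvec_sqr (R : comNzRingType) (n : nat) (u v : 'rV[R]_n) :
  (cvec u * cvec v) ^+ 2 =
  (dot u v *+ 2) *: (cvec u * cvec v) - (dot u u * dot v v)%:A.
Proof.
have norm : cvec u * cvec v * (cvec v * cvec u) = (dot u u * dot v v)%:A.
  rewrite mulrA -[_ * cvec v * cvec v]mulrA cvec_sqr -scalerAr mulr1.
  by rewrite -scalerAl cvec_sqr scalerA mulrC.
apply/eqP; rewrite eq_sym subr_eq -norm expr2 -mulrDr cvec_anticomm.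
by rewrite -scalerAr mulr1.
Qed.

Lemma mul_cvec_exp_grade1 (R : comNzRingType) (n : nat) (u v : 'rV[R]_n) p :
  (cvec u * cvec v) ^+ p * cvec v \in grade 1.
Proof.
apply/grade1P; set a := cvec u * cvec v.
(* The recurrence has order two, so the induction carries two terms. *)
suff [] : (exists w, a ^+ p * cvec v = cvec w) /\
          (exists w, a ^+ p.+1 * cvec v = cvec w) by [].
elim: p => [|p [[w0 Ew0] [w1 Ew1]]].
  split; first by exists v; rewrite mul1r.
  exists (dot v v *: u).
  by rewrite expr1 -mulrA cvec_sqr -scalerAr mulr1 linearZ.
split; first by exists w1.
exists ((dot u v *+ 2) *: w1 - (dot u u * dot v v) *: w0).
rewrite -addn2 exprD mul_cvec_sqr -/a mulrBr mulrBl -!scalerAr mulr1.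
by rewrite -!scalerAl -exprSr Ew0 Ew1 linearB !linearZ.
Qed.

Theorem proposition3 (R : realType) (n : nat) (n_gt0 : (0 < n)%N)
    (e : n.-tuple 'rV[R]_n) (e_onb : orthonormal_basis e)
    (x : 'rV[R]_n) (p : nat) (p_ge1 : (1 <= p)%N) :
  let nvec := tnth e (Ordinal n_gt0) in
  (cvec x * cvec nvec) ^+ p * cvec nvec \in grade 1.
Proof. exact: mul_cvec_exp_grade1. Qed.
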